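(* Let $m\ge n\ge2$ be integers with $(m,n)\neq(2,2)$ and let $G_{m,n}=\langle x,y \mid x^m=y^n\rangle$. Let $\mathcal{S}=\{s_1,s_2\}$ with $s_1=xyx^{-m+1}$, $s_2=x^{m-1}y^{-1}$ (ordered in this way), and let $\mathcal{A}=\{a,b\}$ with $a=x$, $b=yx^{-m+1}$. Then: (1) $\mathcal{S}$ defines a Dehornoy-like ordering $<_D$ of $G_{m,n}$. (2) $\mathcal{A}$ defines an isolated left ordering $<_A$ of $G_{m,n}$.
   Context: A left ordering of a group $G$ is a total order $<$ with $g<g' \Rightarrow hg<hg'$; its positive cone is $P=\{g\in G : 1<g\}$. A subset $P\subset G$ is the positive cone of a (unique) left ordering iff $P\cdot P\subset P$ and $G=P\sqcup\{1\}\sqcup P^{-1}$. The set $\mathrm{LO}(G)$ of left orderings is topologized as a subspace of $2^{G-\{1\}}$ (product topology, $2$ discrete) by identifying an ordering with its positive cone; an isolated ordering is an isolated point of $\mathrm{LO}(G)$. For an ordered generating set $\mathcal{S}=\{s_1,s_2\}$, the set $\Sigma_{\mathcal{S}}$ of $\sigma(\mathcal{S})$-positive elements consists of the elements represented either by a word on $s_1,s_2^{\pm1}$ containing at least one $s_1$ and no $s_1^{-1}$, or by $s_2^k$ with $k\ge1$. $\mathcal{S}$ defines a Dehornoy-like ordering $<_D$ if $\Sigma_{\mathcal{S}}$ is the positive cone of a left ordering $<_D$. A generating set $\mathcal{A}$ defines an isolated ordering $<_A$ if the set $P_{\mathcal{A}}$ of elements represented by nonempty words in the elements of $\mathcal{A}$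 (no inverses) is the positive cone of an isolated left ordering $<_A$. *)

(* Defs.v *)
From HB Require Import structures.
From mathcomp Require Import all_boot.
From mathcomp Require Import boolp classical_sets topology.

Set Implicit Arguments.
Unset Strict Implicit.
Unset Printing Implicit Defensive.

Local Open Scope group_scope.
Local Open Scope classical_set_scope.
Local Open Scope quotient_scope.

(* A word on k letters and their formal inverses: [(i, false)] is the i-th
   letter and [(i, true)] its inverse. *)
Definition word (k : nat) : Type := seq ('I_k * bool).

Definition linv (k : nat) (l : 'I_k * bool) : 'I_k * bool := (l.1, ~~ l.2).

Definition eval (G : groupType) (k : nat) (s : k.-tuple G) (w : word k) : G :=
  \prod_(l <- w) (if l.2 then (tnth s l.1)^-1 else tnth s l.1).

Definition generates (G : groupType) (k : nat) (s : k.-tuple G) : Prop :=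
  forall g : G, exists w : word k, g = eval s w.

(* The pairs [(u, v)] in [R] stand for the relations u = v; [word_eq R] is the
   congruence they generate together with the free cancellations. *)
Inductive word_eq (k : nat) (R : seq (word k * word k)) :
    word k -> word k -> Prop :=
| word_eq_refl u : word_eq R u u
| word_eq_sym u v : word_eq R u v -> word_eq R v u
| word_eq_trans u v w : word_eq R u v -> word_eq R v w -> word_eq R u w
| word_eq_cat u u' v v' :
    word_eq R u u' -> word_eq R v v' -> word_eq R (u ++ v) (u' ++ v')
| word_eq_cancel l : word_eq R [:: l; linv l] [::]
| word_eq_rel u v : (u, v) \in R -> word_eq R u v.

Section Presented.
Variables (k : nat) (R : seq (word k * word k)).

Definition word_eqb (u v : word k) : bool := `[< word_eq R u v >].

Lemma word_eqb_refl : reflexive word_eqb.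
Proof. by move=> u; apply/asboolP; apply: word_eq_refl. Qed.

Lemma word_eqb_sym : symmetric word_eqb.
Proof.
by move=> u v; apply/idP/idP => /asboolP h; apply/asboolP; apply: word_eq_sym.
Qed.

Lemma word_eqb_trans : transitive word_eqb.
Proof.
move=> v u w /asboolP h1 /asboolP h2; apply/asboolP.
exact: word_eq_trans h1 h2.
Qed.

Canonical word_eqb_equiv :=
  EquivRel word_eqb word_eqb_refl word_eqb_sym word_eqb_trans.

Definition presented : Type := {eq_quot word_eqb_equiv}.
HB.instance Definition _ := EqQuotient.on presented.
HB.instance Definition _ := Choice.on presented.

Definition word_class (u : word k) : presented := \pi_presented u.

Lemma word_classP (u v : word k) : word_class u = word_class v <-> word_eq R u v.
Proof. by split=> [/eqquotP/asboolP|h]; last by apply/eqquotP/asboolP. Qed.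

Lemma repr_word_class (u : word k) : word_eq R (repr (word_class u)) u.
Proof. by apply/word_classP; rewrite /word_class reprK. Qed.

Lemma word_class_repr (g : presented) : word_class (repr g) = g.
Proof. exact: reprK. Qed.

Definition word_inv (w : word k) : word k := rev (map (@linv k) w).

Lemma linvK : involutive (@linv k).
Proof. by case=> i b; rewrite /linv /= negbK. Qed.

Lemma word_invK : involutive word_inv.
Proof. by move=> w; rewrite /word_inv map_rev revK mapK //; apply: linvK. Qed.

Lemma word_invr w : word_eq R (w ++ word_inv w) [::].
Proof.
elim: w => [|l w IH]; first exact: word_eq_refl.
rewrite /word_inv /= rev_cons -cats1 -/(word_inv w).
rewrite -[l :: _]/([:: l] ++ (w ++ (word_inv w ++ [:: linv l]))).
apply: (word_eq_trans (v := [:: l] ++ [:: linv l])); last exact: word_eq_cancel.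
apply: word_eq_cat; first exact: word_eq_refl.
by rewrite catA -[X in word_eq R _ X]cat0s; apply: word_eq_cat IH _;
  apply: word_eq_refl.
Qed.

Lemma word_invl w : word_eq R (word_inv w ++ w) [::].
Proof. by rewrite -{2}(word_invK w); apply: word_invr. Qed.

Lemma word_eq_inv u v : word_eq R u v -> word_eq R (word_inv u) (word_inv v).
Proof.
move=> uv; rewrite -[word_inv u]cats0.
apply: (word_eq_trans (v := word_inv u ++ (v ++ word_inv v))).
  apply: word_eq_cat; first exact: word_eq_refl.
  by apply: word_eq_sym; apply: word_invr.
rewrite catA -[X in word_eq R _ X]cat0s.
apply: word_eq_cat; last exact: word_eq_refl.
apply: word_eq_trans (word_invl u).
by apply: word_eq_cat; [exact: word_eq_refl | exact: word_eq_sym].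
Qed.

Definition pres_one : presented := word_class [::].
Definition pres_mul (g h : presented) : presented :=
  word_class (repr g ++ repr h).
Definition pres_inv (g : presented) : presented :=
  word_class (word_inv (repr g)).

Lemma pres_mulE u v : pres_mul (word_class u) (word_class v) = word_class (u ++ v).
Proof. by apply/word_classP; apply: word_eq_cat; apply: repr_word_class. Qed.

Lemma pres_invE u : pres_inv (word_class u) = word_class (word_inv u).
Proof. by apply/word_classP; apply: word_eq_inv; apply: repr_word_class. Qed.

Lemma pres_mulA : associative pres_mul.
Proof.
move=> x y z; rewrite -(word_class_repr x) -(word_class_repr y) -(word_class_repr z).
by rewrite !pres_mulE catA.
Qed.

Lemma pres_mul1 : left_id pres_one pres_mul.
Proof. by move=> x; rewrite -(word_class_repr x) pres_mulE. Qed.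

Lemma pres_mulr1 : right_id pres_one pres_mul.
Proof. by move=> x; rewrite -(word_class_repr x) pres_mulE cats0. Qed.

Lemma pres_mulV : left_inverse pres_one pres_inv pres_mul.
Proof.
move=> x; rewrite -(word_class_repr x) pres_invE pres_mulE.
by apply/word_classP; apply: word_invl.
Qed.

Lemma pres_mulrV : right_inverse pres_one pres_inv pres_mul.
Proof.
move=> x; rewrite -(word_class_repr x) pres_invE pres_mulE.
by apply/word_classP; apply: word_invr.
Qed.

HB.instance Definition _ := isGroup.Build presented
  pres_mulA pres_mul1 pres_mulr1 pres_mulV pres_mulrV.

Definition pres_gen (i : 'I_k) : presented := word_class [:: (i, false)].

Definition pres_gens : k.-tuple presented := mktuple pres_gen.

Lemma word_class_eval (w : word k) : word_class w = eval pres_gens w.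
Proof.
rewrite /eval; elim: w => [|[i b] w IH]; first by rewrite big_nil.
rewrite big_cons -IH -cat1s -pres_mulE tnth_mktuple /=.
by case: b; rewrite // /pres_gen -[(_)^-1]/(pres_inv _) pres_invE.
Qed.

Lemma pres_generates : generates pres_gens.
Proof. by move=> g; exists (repr g); rewrite -word_class_eval word_class_repr. Qed.

Lemma pres_rel u v : (u, v) \in R -> eval pres_gens u = eval pres_gens v.
Proof. by move=> uv; rewrite -!word_class_eval; apply/word_classP/word_eq_rel. Qed.

Lemma eval_word_eq (H : groupType) (t : k.-tuple H) :
  (forall u v, (u, v) \in R -> eval t u = eval t v) ->
  forall u v, word_eq R u v -> eval t u = eval t v.
Proof.
move=> tR u v; elim=> {u v} //.
- by move=> u v w _ -> _ ->.
- by move=> u u' v v' _ e1 _ e2; move: e1 e2; rewrite /eval !big_cat /= => -> ->.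
- move=> [i b]; rewrite /eval !big_cons !big_nil /= mulg1.
  by case: b; rewrite /= ?mulVg ?mulgV.
Qed.

Lemma pres_universal (H : groupType) (t : k.-tuple H) :
  (forall u v, (u, v) \in R -> eval t u = eval t v) ->
  exists2 f : presented -> H,
    {morph f : g h / g * h} & forall i, f (pres_gen i) = tnth t i.
Proof.
move=> tR; exists (fun g => eval t (repr g)).
  move=> g h; rewrite -[g * h]/(pres_mul _ _) /pres_mul.
  rewrite (eval_word_eq tR (repr_word_class _)) /eval big_cat //.
move=> i; rewrite (eval_word_eq tR (repr_word_class _)) /eval big_seq1 //.
Qed.

End Presented.

(* < x, y | x^m = y^n >, where x and y are the letters 0 and 1. *)
Definition Gmn (m n : nat) : groupType :=
  presented [:: (nseq m (ord0 : 'I_2, false), nseq n (ord_max : 'I_2, false))].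

Definition gx (m n : nat) : Gmn m n := pres_gen _ ord0.
Definition gy (m n : nat) : Gmn m n := pres_gen _ ord_max.

Lemma Gmn_rel (m n : nat) : gx m n ^+ m = gy m n ^+ n.
Proof.
have E (i : 'I_2) p : eval (pres_gens [:: (nseq m (ord0 : 'I_2, false),
    nseq n (ord_max : 'I_2, false))]) (nseq p (i, false)) = pres_gen _ i ^+ p.
  elim: p => [|p IH]; first by rewrite /eval big_nil.
  by move: IH; rewrite /eval big_cons expgS => ->; rewrite tnth_mktuple.
by rewrite -!E; apply: pres_rel; rewrite mem_seq1.
Qed.

Section LeftOrderings.
Variable G : groupType.

Definition left_ordering (lt : rel G) : Prop :=
  [/\ irreflexive lt,
      transitive lt,
      (forall g g' : G, g <> g' -> lt g g' \/ lt g' g) &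
      (forall h g g' : G, lt g g' -> lt (h * g) (h * g'))].

Definition positive_cone (lt : rel G) : set G := [set g | lt 1 g].

(* 2^(G - {1}); [bool] carries the discrete topology. *)
Definition cone_space := prod_topology (fun _ : {g : G | g != 1} => bool).

Definition cone_point (lt : rel G) : cone_space :=
  fun g => val g \in positive_cone lt.

Definition LO : set cone_space := [set cone_point lt | lt in left_ordering].

(* [isolated LO] quantifies over neighbourhoods in [cone_space], i.e. it uses
   the subspace topology of [LO]. *)
Definition isolated_ordering (lt : rel G) : Prop :=
  left_ordering lt /\ isolated LO (cone_point lt).

Definition sigma_positive (s : 2.-tuple G) : set G :=
  [set g | (exists w : word 2,
              [/\ (ord0, false) \in w, (ord0, true) \notin w & g = eval s w])
        \/ (exists2 k : nat, (1 <= k)%N & g = tnth s ord_max ^+ k)].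

Definition defines_Dehornoy_like (s : 2.-tuple G) : Prop :=
  generates s /\
  exists2 lt : rel G, left_ordering lt & sigma_positive s = positive_cone lt.

Definition word_positive (k : nat) (s : k.-tuple G) : set G :=
  [set g | exists2 w : seq 'I_k, w <> [::] & g = \prod_(i <- w) tnth s i].

Definition defines_isolated (k : nat) (s : k.-tuple G) : Prop :=
  generates s /\
  exists2 lt : rel G, isolated_ordering lt & word_positive s = positive_cone lt.

End LeftOrderings.

(* Main.v *)
From mathcomp Require Import all_boot all_order all_algebra.
From mathcomp Require Import boolp classical_sets topology.
Require Import Defs.
Set Implicit Arguments.
Unset Strict Implicit.
Unset Printing Implicit Defensive.
Local Open Scope classical_set_scope.
Local Open Scope group_scope.

(** Put [a = x], [b = y x^(1-m)] and [z = x^m = y^n], which is central. Then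
    [s1 = a b] and [s2 = b^-1], so both generating sets speak about the same
    set Q: the products of letters [a], [b], [b^-1] in which [a] occurs. The
    sigma-positive elements are Q together with the [b^-k], [k >= 1]. The
    relation reads [b^-1 a = a^(m-1) y^(n-2) b] and [a b^-1 = y^(n-1)], with
    [y = b a^(m-1)], so an [a] can swallow any neighbouring [b^-1]; hence every
    element of Q is also a product of [a]s and [b]s only, and the elements
    represented by positive words in [a, b] are Q together with the [b^k],
    [k >= 1] ([sigma_positiveE], [word_positiveE]). The two orderings thus agree
    off the cyclic subgroup generated by [b] and are opposite on it.

    Both parts therefore follow once the group is the disjoint union of Q, the
    powers of [b] and the inverses of Q, and [b] has infinite order
    ([ab_cone_is_cone]).

    That the three sets cover the group ([ab_monoid_total]) is a ping-pong
    estimate. Let M be the monoid generated by [a, b, b^-1], and think of [M] as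
    the nonnegative elements. Modulo [z] the group is a free product of two
    cyclic groups, so each element is a power of [z] times an alternating
    product of syllables. By induction on the syllables, an alternating product
    starting with a power of [y] (normalized by [z^-1]) lies between [1] and
    [x], and one starting with a power of [x] lies between [x] and [z]
    ([alternating_bounds]). So every element is [z^k h] with [h] between [1] and
    [z], and the sign of [k] decides whether it or its inverse is in M.

    That Q avoids [1] ([ab_product_neq1]) is seen on an order-preserving action
    on the rationals ([Gmn_act]): [y] is the translation by [1/n], and [x] is a
    conjugate of the translation by [1/m] under an increasing bijection chosen
    to commute with the translation by [1] (so that [x^m = y^n]) and such that
    [b] fixes [0] while [x] moves [0] up. Every element of Q then moves [0]
    strictly up. If [b^k] were [1] for some [k >= 1], the [k]th power of
    [x^-1 b^-1 x], which is in Q as soon as [m > 2], would be [1] as well.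

    Finally, a positive cone generated as a semigroup by finitely many elements
    is isolated, since an ordering in which all of them are positive has a
    larger, hence equal, cone ([word_positive_isolated]). *)

(** * Left orderings and positive cones *)

Section Cones.
Variable G : groupType.
Implicit Types (P : set G) (lt : rel G).

Definition is_cone P : Prop :=
  [/\ forall g h, P g -> P h -> P (g * h), ~ P 1 &
      forall g, g <> 1 -> P g \/ P g^-1].

Lemma is_cone_left_ordering P : is_cone P ->
  exists2 lt, left_ordering lt & P = positive_cone lt.
Proof.
case=> PM P1 PV; exists (fun g h => `[< P (g^-1 * h) >]).
  split.
  - by move=> g; apply/asboolP; rewrite mulVg.
  - move=> h g k /asboolP gh /asboolP hk; apply/asboolP.
    by rewrite -(mulVKg h k) mulgA; apply: PM.
  - move=> g h gh; have [|P_gh|] := PV (g^-1 * h).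
    + by move=> e; apply: gh; rewrite -[h](mulVKg g) e mulg1.
    + by left; apply/asboolP.
    + by rewrite invgM invgK => P_hg; right; apply/asboolP.
  - by move=> k g h /asboolP gh; apply/asboolP; rewrite invgM -mulgA mulKg.
apply/seteqP; split=> g /= Pg; first by apply/asboolP; rewrite invg1 mul1g.
by move/asboolP: Pg; rewrite invg1 mul1g.
Qed.

Lemma left_ordering_is_cone lt :
  left_ordering lt -> is_cone (positive_cone lt).
Proof.
case=> irr tr tot mul; split=> [g h Pg Ph||g /nesym g1].
- by apply: tr Pg _; have := mul g _ _ Ph; rewrite mulg1.
- by rewrite /positive_cone /= irr.
- have [Pg|gP] := tot _ _ g1; first by left.
  by right; have := mul g^-1 _ _ gP; rewrite mulVg mulg1.
Qed.

(** An element [g] of the larger cone outside the smaller one would have its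
    inverse in the smaller cone, so the larger one would contain [1]. *)
Lemma positive_cone_maximal lt lt' :
  left_ordering lt -> left_ordering lt' ->
  positive_cone lt `<=` positive_cone lt' ->
  positive_cone lt = positive_cone lt'.
Proof.
move=> /left_ordering_is_cone[_ _ PV] /left_ordering_is_cone[PM' P'1 _] sPP'.
apply/seteqP; split=> // g P'g.
have [e|/PV[//|PgV]] := EM (g = 1); first by rewrite e in P'g.
by case: P'1; rewrite -(mulgV g); apply: PM' P'g (sPP' _ PgV).
Qed.

(** The neighbourhood isolating the ordering asks that the finitely many
    generators stay positive. *)
Lemma word_positive_isolated k (s : k.-tuple G) lt :
  left_ordering lt -> word_positive s = positive_cone lt ->
  isolated_ordering lt.
Proof.
move=> lo Es; split=> //.
have s_pos i : positive_cone lt (tnth s i).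
  by rewrite -Es; exists [:: i] => //; rewrite big_seq1.
have s1 i : tnth s i != 1.
  apply/eqP => e; have [_ + _] := left_ordering_is_cone lo.
  by rewrite -e; apply; apply: s_pos.
split; first by apply/mem_set; exists lt.
pose e i : {g : G | g != 1} := exist (fun g => g != 1) (tnth s i) (s1 i).
have e_pos i : cone_point lt (e i) = true by apply/mem_set/s_pos.
exists [set f : cone_space G | forall i, f (e i) = true].
  apply: (@filter_forall _ _ (fun i (f : cone_space G) => f (e i) = true) _
    (nbhs_filter (cone_point lt : cone_space G))) => i.
  apply: (@proj_continuous _ (fun=> bool) (e i) (cone_point lt) [set true]).
  by rewrite -[X in nbhs X]/(cone_point lt (e i)) e_pos; apply: discrete_set1.
apply/seteqP; split=> [f [Vf [lt' lo' ltf]]|f ->] /=; last first.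
  split; last by exists lt.
  exact: e_pos.
rewrite -ltf /cone_point; apply/funext => g.
rewrite (positive_cone_maximal lo lo') //.
rewrite -Es => _ [w w0 ->].
have [PM _ _] := left_ordering_is_cone lo'.
have P's i : positive_cone lt' (tnth s i).
  by have := Vf i; rewrite -ltf => /set_mem.
case: w w0 => // i w _; elim: w i => [|j w IH] i; first by rewrite big_seq1.
by rewrite big_cons; apply: PM.
Qed.

End Cones.

(** * Products of a, b and the inverse of b *)

(** Products of letters [a], [b] and, if the flag [V] is set, [b^-1]. The boolean
    index records whether the letter [a] occurs. Keeping both versions in one
    family lets the relation be used in the same way for each. *)
Inductive ab_product (G : groupType) (a b : G) (V : bool) : bool -> G -> Prop :=
| ab_product1 : ab_product a b V false 1
| ab_product_a t g : ab_product a b V t g -> ab_product a b V true (a * g)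
| ab_product_b t g : ab_product a b V t g -> ab_product a b V t (b * g)
| ab_product_bV t g :
    V -> ab_product a b V t g -> ab_product a b V t (b^-1 * g).

Lemma ord2P (i : 'I_2) : i = ord0 \/ i = ord_max.
Proof. by case: i => [[|[|//]] lti]; [left|right]; apply: val_inj. Qed.

Section AbProduct.
Variables (G : groupType) (a b : G).
Local Notation Q := (ab_product a b).

Lemma ab_productM V t u g h : Q V t g -> Q V u h -> Q V (t || u) (g * h).
Proof.
move=> Qg Qh; elim: Qg => [|{}t {}g _ IH|{}t {}g _ IH|{}t {}g VT _ IH].
- by rewrite mul1g.
- by rewrite -mulgA; apply: ab_product_a IH.
- by rewrite -mulgA; apply: ab_product_b.
- by rewrite -mulgA; apply: ab_product_bV.
Qed.

Lemma ab_product_letter_a V : Q V true a.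
Proof. by have := ab_product_a (ab_product1 a b V); rewrite mulg1. Qed.

Lemma ab_product_letter_b V : Q V false b.
Proof. by have := ab_product_b (ab_product1 a b V); rewrite mulg1. Qed.

Lemma ab_productX V t g k : Q V t g -> Q V (t && (0 < k)%N) (g ^+ k).
Proof.
move=> Qg; elim: k => [|k IH]; first by rewrite andbF; apply: ab_product1.
by rewrite andbT expgS -[t](orb_idr (b := t && (0 < k)%N)) => [|/andP[]//];
  apply: ab_productM.
Qed.

Lemma ab_product_false V g : Q V false g -> exists k, g = b ^+ k \/ g = b ^- k.
Proof.
move Et: false => t Qg; elim: Qg Et => [|//|{}t {}g _ IH|{}t {}g _ _ IH] Et.
- by exists 0%N; left.
- have [[|k] [->|->]] := IH Et.
  + by exists 1%N; left; rewrite mulg1.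
  + by exists 1%N; left; rewrite invg1 mulg1.
  + by exists k.+2; left; rewrite [in RHS]expgS.
  + by exists k; right; rewrite expgSr invgM mulVKg.
- have [[|k] [->|->]] := IH Et.
  + by exists 1%N; right; rewrite mulg1.
  + by exists 1%N; right; rewrite invg1 mulg1.
  + by exists k; left; rewrite expgS mulKg.
  + by exists k.+2; right; rewrite [in RHS]expgSr invgM.
Qed.

(** The letter [a] swallows the inverses of [b] on either side of it: those on the
    left are pushed into the next [a] one at a time, and those after the last [a]
    form a single power [b^-k], which is absorbed by [k] uses of the second
    hypothesis. *)
Lemma ab_product_absorb : Q false true (b^-1 * a) -> Q false true (a * b^-1) ->
  forall g, Q true true g -> Q false true g.
Proof.
move=> Qba Qab.
have QbV g : Q false true g -> Q false true (b^-1 * g).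
  move Et: true => t Qg; case: Qg Et => [//|{}t {}g Qg _|{}t {}g Qg Et|//].
    by rewrite mulgA; apply: ab_productM Qba Qg.
  by rewrite mulKg; subst t.
(* Only the empty product can fail to absorb a [b^-1] on its right. *)
have QVb t g : Q false t g -> Q false t (g * b^-1) \/ g = 1 /\ ~~ t.
  elim=> {t g} [|t g Qg IH|t g _ IH|//]; first by right.
    left; case: IH => [IH|[-> _]]; last by rewrite mulg1.
    by rewrite -mulgA; apply: ab_product_a IH.
  left; case: IH => [IH|[-> /negbTE->]]; last first.
    by rewrite mulg1 mulgV; apply: ab_product1.
  by rewrite -mulgA; apply: ab_product_b.
move=> g; move Et: {2}true => t Qg.
elim: Qg Et => [//|{}t {}g Qg IH _|{}t {}g _ IH Et|{}t {}g _ _ IH Et].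
- case: t Qg IH => Qg IH; first exact: ab_product_a (IH _).
  have [k [->|->]] := ab_product_false Qg.
    apply: (ab_productM (u := false) (ab_product_letter_a false)).
    exact: ab_productX (ab_product_letter_b false).
  elim: k => [|k IHk]; first by rewrite invg1 mulg1; apply: ab_product_letter_a.
  by rewrite expgS invgM mulgA; have [|[]] := QVb _ _ IHk.
- by subst t; apply: ab_product_b; apply: IH.
- by subst t; apply: QbV; apply: IH.
Qed.

(** The common shape of the two cones: [c] is [b] or [b^-1], according to the
    sign given to the subgroup generated by [b]. *)
Definition ab_cone (c : G) : set G :=
  [set g | Q true true g \/ exists2 k, (1 <= k)%N & g = c ^+ k].

(** The letters translate as [a = s1 s2] and [b = s2^-1], without creating an
    inverse of [s1]. *)
Lemma sigma_positiveE : sigma_positive [tuple a * b; b^-1] = ab_cone b^-1.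
Proof.
set s := [tuple _; _].
have s0 : tnth s ord0 = a * b by [].
have s1 : tnth s ord_max = b^-1 by [].
have evalS l w : eval s (l :: w) =
    (if l.2 then (tnth s l.1)^-1 else tnth s l.1) * eval s w.
  by rewrite /eval big_cons.
apply/seteqP; split=> g /= -[|[k k1 ->]]; try by right; exists k.
- case=> w [w_a w_aV ->]; left; rewrite -{2}w_a.
  elim: w w_aV {w_a} => [_|[i e] w IH].
    by rewrite /eval big_nil; apply: ab_product1.
  rewrite !in_cons evalS negb_or => /andP[ne /IH{}IH].
  have [Ei|Ei] := ord2P i; subst i; case: e ne; rewrite /= ?s0 ?s1 // => _.
  + by rewrite -mulgA; apply: ab_product_a (ab_product_b IH).
  + by rewrite invgK; apply: ab_product_b.
  + exact: ab_product_bV.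
- suff Qw t h : Q true t h -> exists w : word 2,
      [/\ ((ord0, false) \in w) = t, (ord0, true) \notin w & h = eval s w].
    by move=> /Qw[w [w_a w_aV ->]]; left; exists w.
  elim=> {t h} [|t h _ [w [w_a w_aV ->]]|t h _ [w [w_a w_aV ->]]
               |t h _ _ [w [w_a w_aV ->]]].
  + by exists [::]; rewrite /eval big_nil.
  + exists [:: (ord0, false), (ord_max, false) & w].
    by rewrite !in_cons w_aV !evalS /= s0 s1 mulgA mulgK.
  + by exists ((ord_max, true) :: w); rewrite !in_cons w_aV w_a evalS /= s1 invgK.
  + by exists ((ord_max, false) :: w); rewrite !in_cons w_aV w_a evalS /= s1.
Qed.

Lemma word_positiveE : (forall g, Q true true g -> Q false true g) ->
  word_positive [tuple a; b] = ab_cone b.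
Proof.
move=> absorb; set s := [tuple _; _].
have s0 : tnth s ord0 = a by [].
have s1 : tnth s ord_max = b by [].
apply/seteqP; split=> g /=.
- case=> w w0 ->; have [w_a|w_b] := boolP (ord0 \in w).
    left; rewrite -{2}w_a; elim: w {w0 w_a} => [|i w IH].
      by rewrite big_nil; apply: ab_product1.
    rewrite big_cons in_cons; have [->|->] := ord2P i.
      by rewrite s0; apply: ab_product_a IH.
    by rewrite s1; apply: ab_product_b IH.
  right; exists (size w); first by case: w w0 {w_b}.
  elim: w {w0} w_b => [|i w IH]; first by rewrite big_nil.
  rewrite in_cons negb_or big_cons /= expgS => /andP[i0 /IH->].
  by have [Ei|->] := ord2P i; first by rewrite Ei in i0.
- case=> [/absorb Qg|[[//|k] _ ->]]; last first.
    exists (nseq k.+1 ord_max) => //.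
    elim: k => [|k IH]; first by rewrite big_seq1.
    by rewrite expgS IH [in RHS]big_cons.
  suff Qw t h : Q false t h ->
      exists2 w : seq 'I_2, (ord0 \in w) = t & h = \prod_(i <- w) tnth s i.
    by have [w w_a ->] := Qw _ _ Qg; exists w => //; case: w w_a.
  elim=> {t h} [|t h _ [w w_a ->]|t h _ [w w_a ->]|//].
  + by exists [::]; rewrite ?big_nil.
  + by exists (ord0 :: w); rewrite ?big_cons ?s0.
  + by exists (ord_max :: w); rewrite ?big_cons ?in_cons ?s1.
Qed.

Definition ab_monoid (g : G) : Prop := exists t, Q true t g.

Lemma ab_monoid1 : ab_monoid 1.
Proof. by exists false; apply: ab_product1. Qed.

Lemma ab_monoidM g h : ab_monoid g -> ab_monoid h -> ab_monoid (g * h).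
Proof. by case=> t Qg [u Qh]; exists (t || u); apply: ab_productM. Qed.

Lemma ab_monoidX g k : ab_monoid g -> ab_monoid (g ^+ k).
Proof.
move=> Mg; elim: k => [|k IH]; first exact: ab_monoid1.
by rewrite expgS; apply: ab_monoidM.
Qed.

End AbProduct.

(** * Comparison in a group with x^m = y^n *)

Lemma mulVXg (G : groupType) (g : G) k :
  (0 < k)%N -> g^-1 * g ^+ k = g ^+ (k - 1).
Proof. by case: k => // k _; rewrite expgS mulKg subn1. Qed.

Section Comparison.
Variables (G : groupType) (x y : G) (m n : nat).
Hypotheses (xy : x ^+ m = y ^+ n) (n_gt1 : (1 < n)%N) (m_gt1 : (1 < m)%N).
Local Notation b := (y * x ^- (m - 1)).
Local Notation z := (x ^+ m).
Local Notation M := (ab_monoid x b).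

Let m_gt0 : 0 < m. Proof. exact: ltnW m_gt1. Qed.
Let n_gt0 : 0 < n. Proof. exact: ltn_trans n_gt1. Qed.

Lemma y_b : y = b * x ^+ (m - 1).
Proof. by rewrite mulgVK. Qed.

Lemma x_yb : x = y ^+ (n - 1) * b.
Proof.
by rewrite mulgA -expgSr subn1 prednK // -xy -{1}(prednK m_gt0) expgS subn1 mulgK.
Qed.

(** Together with [xbV], the form in which the relation absorbs [b^-1]; the right
    side involves no inverse because [2 <= n]. *)
Lemma bVx : b^-1 * x = x ^+ (m - 1) * y ^+ (n - 2) * b.
Proof.
apply: (@mulgI _ b); rewrite mulVKg [LHS]x_yb !mulgA -y_b -expgS.
by congr (y ^+ _ * y * _); rewrite -subSn // subSS.
Qed.

Lemma xbV : x * b^-1 = y ^+ (n - 1).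
Proof. by rewrite {1}x_yb mulgK. Qed.

Lemma commute_zx : commute x z.
Proof. exact/commuteX. Qed.

Lemma commute_zy : commute y z.
Proof. by rewrite xy; apply/commuteX. Qed.

Lemma commute_yXz k : commute (y ^+ k) z.
Proof. exact/commute_sym/commuteX/commute_sym/commute_zy. Qed.

Lemma zb : z * b = y * x.
Proof.
by rewrite mulgA -commute_zy -mulgA -{1}(prednK m_gt0) expgS subn1 mulgK.
Qed.

Lemma ab_product_y V : ab_product x b V true y.
Proof.
rewrite {2}y_b; apply: (ab_productM (ab_product_letter_b _ _ _)).
have := ab_productX (m - 1) (ab_product_letter_a x b V).
by rewrite subn_gt0 m_gt1.
Qed.

Lemma ab_monoid_x : M x. Proof. by exists true; apply: ab_product_letter_a. Qed.
Lemma ab_monoid_b : M b. Proof. by exists false; apply: ab_product_letter_b. Qed.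
Lemma ab_monoid_y : M y. Proof. by exists true; apply: ab_product_y. Qed.

(** Alternating products of nontrivial syllables, the normal forms of the free
    product of cyclic groups obtained by killing [z]; the index tells whether the
    product starts with [x]. The powers of [z] are normalized so that the bounds
    below hold: a syllable [y^j] comes with one factor [z^-1], and a product whose
    last syllable is a power of [y] ends with [z] instead of [1]. *)
Inductive alternating : bool -> G -> Prop :=
| alternating1 : alternating false 1
| alternating_z : alternating true z
| alternating_x i h :
    0 < i < m -> alternating false h -> alternating true (x ^+ i * h)
| alternating_y j h :
    0 < j < n -> alternating true h -> alternating false (z^-1 * (y ^+ j * h)).

(** With [g <= h] standing for [M (g^-1 * h)], this says [x <= h <= z] or
    [1 <= h <= x]. A syllable [x^i] with [0 < i < m] sends the interval [1, x] into
    [x, z], because [x^(i+1)] stays below [z]; a syllable [z^-1 y^j] with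
    [0 < j < n] sends [x, z] back into [1, x], because [y^j x = z y^(j-1) b] and
    [x = y^(n-1) b]. *)
Lemma alternating_bounds t h : alternating t h ->
  if t then M (x^-1 * h) /\ M (h^-1 * z) else M h /\ M (h^-1 * x).
Proof.
elim=> {t h} [||i h /andP[i_gt0 ltim] _ [Mh MhV]|j h /andP[j_gt0 ltjn] _ [Mh MhV]].
- by rewrite invg1 mul1g; split; [apply: ab_monoid1 | apply: ab_monoid_x].
- rewrite mulVg mulVXg //.
  by split; [apply/ab_monoidX/ab_monoid_x | apply: ab_monoid1].
- split.
    rewrite mulgA mulVXg //.
    by apply: ab_monoidM Mh; apply/ab_monoidX/ab_monoid_x.
  have -> : (x ^+ i * h)^-1 * z = h^-1 * x * x ^+ (m - i.+1).
    rewrite invgM -!mulgA -expgS subnSK //; congr (_ * _).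
    by apply: (@mulgI _ (x ^+ i)); rewrite mulVKg -expgnDr subnKC // ltnW.
  by apply: ab_monoidM MhV _; apply/ab_monoidX/ab_monoid_x.
- split.
    have -> : z^-1 * (y ^+ j * h) = y ^+ (j - 1) * b * (x^-1 * h).
      move: zb; move: (b) => c zc; apply: (@mulgI _ z); rewrite mulVKg.
      rewrite !mulgA -commute_yXz -(mulgA _ z) zc !mulgA mulgK.
      by rewrite -expgSr subn1 prednK.
    apply: ab_monoidM Mh; apply: ab_monoidM ab_monoid_b.
    exact/ab_monoidX/ab_monoid_y.
  have -> : (z^-1 * (y ^+ j * h))^-1 * x = h^-1 * z * (y ^+ (n - j.+1) * b).
    move: x_yb; move: (b) => c xc; rewrite !invgM invgK -!mulgA; congr (_ * _).
    apply: (@mulgI _ (y ^+ j)); rewrite mulVKg !mulgA commute_yXz.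
    by rewrite -(mulgA z) -expgnDr addnBA // -[j.+1]addn1 subnDl -mulgA -xc.
  apply: ab_monoidM MhV _; apply: ab_monoidM ab_monoid_b.
  exact/ab_monoidX/ab_monoid_y.
Qed.

Hypothesis generated : forall K : G -> Prop, K 1 ->
  (forall g, K g -> [/\ K (x * g), K (x^-1 * g), K (y * g) & K (y^-1 * g)]) ->
  forall g, K g.

Lemma commute_z g : commute g z.
Proof.
elim/generated: g => [|g zg]; first exact/commute_sym/commute1.
have cM h : commute h z -> commute (h * g) z.
  by move=> zh; apply/commute_sym/commuteM; apply/commute_sym.
have cMV h : commute h z -> commute (h^-1 * g) z.
  by move=> zh; apply/cM/commute_sym/commuteV/commute_sym.
by split; [apply/cM/commute_zx | apply/cMV/commute_zx
          | apply/cM/commute_zy | apply/cMV/commute_zy].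
Qed.

(** The elements admitting such an expression are stable under multiplication by
    the generators: a new letter lengthens the first syllable, starts a new one,
    or completes a power equal to [z], which is central. Inverses of
    generators are positive powers of them times [z^-1]. Two exponents are used in
    place of a signed one. *)
Lemma alternating_generate g : exists k l t h,
  alternating t h /\ z ^+ k * g = z ^+ l * h.
Proof.
move: g; pose K g := exists k l t h, alternating t h /\ z ^+ k * g = z ^+ l * h.
have KzV g : K g -> K (z^-1 * g).
  case=> k [l [t [h [th gh]]]]; exists k.+1, l, t, h; split=> //.
  by rewrite expgSr -mulgA mulVKg.
have Kx g : K g -> K (x * g).
  case=> k [l [t [h [th gh]]]].
  suff [j [u [h' [uh' xh]]]] :
      exists j u h', alternating u h' /\ x * h = z ^+ j * h'.
    exists k, (l + j), u, h'; split => //.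
    rewrite mulgA -(commuteX _ (commute_z x)) -mulgA gh mulgA.
    by rewrite (commuteX _ (commute_z x)) -mulgA xh mulgA expgnDr.
  case: th {gh} => [||i {}h /andP[i_gt0 lim] Ah|j {}h j_n Ah].
  - exists 0%N, true, (x ^+ 1 * 1); split; last by rewrite mul1g.
    by apply: alternating_x _ alternating1; rewrite m_gt1.
  - exists 1%N, true, (x ^+ 1 * 1); split; last by rewrite mulg1 commute_z.
    by apply: alternating_x _ alternating1; rewrite m_gt1.
  - have [lim1|lem] := ltnP i.+1 m.
      exists 0%N, true, (x ^+ i.+1 * h); split; last by rewrite mul1g mulgA -expgS.
      exact: alternating_x _ Ah.
    exists 1%N, false, h; split=> //.
    by rewrite mulgA -expgS; congr (_ ^+ _ * _); apply/eqP; rewrite eqn_leq lim.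
  - exists 0%N, true, (x ^+ 1 * (z^-1 * (y ^+ j * h))).
    split; last by rewrite mul1g.
    by apply: alternating_x; [rewrite m_gt1 | apply: alternating_y].
have Ky g : K g -> K (y * g).
  case=> k [l [t [h [th gh]]]].
  suff [j [u [h' [uh' xh]]]] :
      exists j u h', alternating u h' /\ y * h = z ^+ j * h'.
    exists k, (l + j), u, h'; split => //.
    rewrite mulgA -(commuteX _ (commute_z y)) -mulgA gh mulgA.
    by rewrite (commuteX _ (commute_z y)) -mulgA xh mulgA expgnDr.
  have yA h' : alternating true h' ->
     exists j u h'', alternating u h'' /\ y * h' = z ^+ j * h''.
    move=> Ah; exists 1%N, false, (z^-1 * (y ^+ 1 * h')).
    by split; [apply: alternating_y | rewrite mulVKg].
  case: th {gh} => [||i {}h i_m Ah|j {}h /andP[j_gt0 ljn] Ah].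
  - exists 0%N, false, (z^-1 * (y ^+ 1 * z)).
    split; first exact/alternating_y/alternating_z.
    by rewrite mul1g commute_z mulKg mulg1.
  - exact/yA/alternating_z.
  - exact/yA/alternating_x.
  - have [ljn1|lej] := ltnP j.+1 n.
      exists 0%N, false, (z^-1 * (y ^+ j.+1 * h)).
      split; first exact: alternating_y _ Ah.
      by rewrite mul1g expgS !mulgA (commuteV (commute_z y)).
    exists 0%N, true, h; split=> //.
    rewrite mul1g mulgA (commuteV (commute_z y)) -mulgA (mulgA y) -expgS.
    have -> : j.+1 = n by apply/eqP; rewrite eqn_leq ljn.
    by rewrite -xy mulKg.
have KX (s : G) k : (forall h, K h -> K (s * h)) -> forall h, K h -> K (s ^+ k * h).
  move=> Ks h Kh; elim: k => [|k IH]; first by rewrite mul1g.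
  by rewrite expgS -mulgA; apply: Ks.
apply: generated => [|g Kg].
  by exists 0%N, 0%N, false, 1; split; first exact: alternating1.
have xV : x^-1 = z^-1 * x ^+ (m - 1).
  by rewrite -(mulVXg _ m_gt0) -(commuteV (commute_z _)) mulgK.
have yV : y^-1 = z^-1 * y ^+ (n - 1).
  by rewrite -(mulVXg _ n_gt0) -xy -(commuteV (commute_z _)) mulgK.
split; [exact: Kx | rewrite xV -mulgA | exact: Ky | rewrite yV -mulgA].
  exact/KzV/KX.
exact/KzV/KX.
Qed.

(** Writing [g = z^(l-k) h] with [1 <= h <= z] for the order of M, the element [g]
    is in M if [k <= l], and otherwise [g^-1 = (h^-1 z) z^(k-l-1)] is. *)
Lemma ab_monoid_total g : M g \/ M g^-1.
Proof.
have [k [l [t [h [Ah gh]]]]] := alternating_generate g.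
have [Mh MhV] : M h /\ M (h^-1 * z).
  have := alternating_bounds Ah; case: t {Ah} => -[Mh MhV]; split=> //.
    by rewrite -[h](mulVKg x); apply: ab_monoidM ab_monoid_x Mh.
  have -> : z = x * x ^+ (m - 1) by rewrite -(mulVXg _ m_gt0) mulVKg.
  by rewrite mulgA; apply: ab_monoidM MhV _; apply/ab_monoidX/ab_monoid_x.
have Mz : M z by apply/ab_monoidX/ab_monoid_x.
have -> : g = z ^- k * z ^+ l * h by rewrite -mulgA -gh mulKg.
have [lekl|ltlk] := leqP k l.
  left; rewrite -{1}(subnKC lekl) expgnDr mulKg.
  by apply: ab_monoidM Mh; apply: ab_monoidX.
right; rewrite !invgM invgK -(subnKC ltlk) addSnnS expgnDr mulKg.
by rewrite expgS mulgA; apply: ab_monoidM MhV _; apply: ab_monoidX.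
Qed.

Lemma ab_product_bVx V : ab_product x b V true (b^-1 * x).
Proof.
rewrite bVx; apply: (ab_productM (t := true) _ (ab_product_letter_b _ _ _)).
apply: (ab_productM (t := true)) (ab_productX (n - 2) (ab_product_y V)).
have := ab_productX (m - 1) (ab_product_letter_a x b V).
by rewrite subn_gt0 m_gt1.
Qed.

Lemma ab_product_xbV V : ab_product x b V true (x * b^-1).
Proof.
by rewrite xbV; have := ab_productX (n - 1) (ab_product_y V); rewrite subn_gt0 n_gt1.
Qed.

Hypothesis m_gt2 : (2 < m)%N.

(** One [x] of [b^-1 x = x^(m-1) y^(n-2) b] cancels in the conjugate, and at least
    one remains because [2 < m]. *)
Lemma ab_product_conj_bV V : ab_product x b V true (b^-1 ^ x).
Proof.
have -> : b^-1 ^ x = x ^+ (m - 2) * y ^+ (n - 2) * b.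
  rewrite conjgE bVx; move: (b) => c; rewrite !mulgA mulVXg ?subn_gt0 ?m_gt1 //.
  by rewrite -subnDA.
apply: (ab_productM (t := true) _ (ab_product_letter_b _ _ _)).
apply: (ab_productM (t := true)) (ab_productX (n - 2) (ab_product_y V)).
have := ab_productX (m - 2) (ab_product_letter_a x b V).
by rewrite subn_gt0 m_gt2.
Qed.

Hypothesis ab_product_neq1 : ~ ab_product x b true true 1.

(** A power of [b] equal to [1] makes the same power of the conjugate of [b^-1] by
    [x] equal to [1], although this conjugate is a product containing [x]. *)
Lemma expg_b_neq1 k : (0 < k)%N -> b ^+ k <> 1.
Proof.
move=> k_gt0 bk1; apply: ab_product_neq1.
have := ab_productX k (ab_product_conj_bV true).
by rewrite k_gt0 -conjXg expVgn bk1 invg1 conj1g.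
Qed.

Lemma ab_cone_is_cone c : c = b \/ c = b^-1 -> is_cone (ab_cone x b c).
Proof.
move=> cb.
have Qc k : ab_product x b true false (c ^+ k).
  apply: (ab_productX (t := false)); case: cb => ->.
    exact: ab_product_letter_b.
  by have := ab_product_bV isT (ab_product1 x b true); rewrite mulg1.
split=> [g h [Qg|[k k1 ->]] [Qh|[l l1 ->]]||g g1].
- by left; apply: ab_productM Qg Qh.
- by left; apply: ab_productM Qg (Qc l).
- by left; apply: ab_productM (Qc k) Qh.
- by right; exists (k + l)%N; rewrite ?expgnDr ?addn_gt0 ?k1.
- case=> [//|[k k1 ck]]; apply: (expg_b_neq1 k1).
  by case: cb ck => -> ck; rewrite ?ck // -[LHS]invgK -expVgn -ck invg1.
- have Cc k : c ^+ k <> 1 -> ab_cone x b c (c ^+ k).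
    by case: k => // k _; right; exists k.+1.
  have M_cone h : h <> 1 -> ab_monoid x b h -> ab_cone x b c h \/ ab_cone x b c h^-1.
    move=> h1 [[] Qh]; first by left; left.
    have [k hk] : exists k, h = c ^+ k \/ h = c ^- k.
      have [k hk] := ab_product_false Qh; exists k.
      case: cb => ->; rewrite ?expVgn ?invgK //; by case: hk; [right|left].
    case: hk h1 => -> h1; first by left; apply: Cc.
    by right; rewrite invgK; apply: Cc => ck; apply: h1; rewrite ck invg1.
  have [/(M_cone _ g1)//|/M_cone[|?|]] := ab_monoid_total g.
  + by move=> gV1; apply: g1; rewrite -[g]invgK gV1 invg1.
  + by right.
  + by rewrite invgK; left.
Qed.

End Comparison.

(** * An action on the rational line *)

Section Stretch.
Import Order.TTheory GRing.Theory Num.Theory.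
Local Open Scope ring_scope.
Implicit Types d r t : rat.

(** In the coordinate [u = r / (1 - r)], which identifies the interval from 0 to 1
    with the positive half line, this is the multiplication [u |-> d u]. Hence the
    inverse is given by the same formula for [d^-1]. *)
Definition stretch01 d r : rat := d * r / (1 - r + d * r).

Definition stretch d t : rat :=
  (Num.floor t)%:~R + stretch01 d (t - (Num.floor t)%:~R).

Lemma stretch01_den_gt0 d r : 0 < d -> 0 <= r < 1 -> 0 < 1 - r + d * r.
Proof.
by move=> d0 /andP[r0 r1]; rewrite ltr_wpDr ?mulr_ge0 ?(ltW d0) // subr_gt0.
Qed.

Lemma stretch01_itv d r : 0 < d -> 0 <= r < 1 -> 0 <= stretch01 d r < 1.
Proof.
move=> d0 r01; have D0 := stretch01_den_gt0 d0 r01; case/andP: r01 => r0 r1.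
rewrite /stretch01 divr_ge0 ?(ltW D0) ?mulr_ge0 ?(ltW d0) //=.
by rewrite ltr_pdivrMr // mul1r ltrDr subr_gt0.
Qed.

Lemma stretch01K d r : 0 < d -> 0 <= r < 1 ->
  stretch01 d^-1 (stretch01 d r) = r.
Proof.
move=> d0 /(stretch01_den_gt0 d0) D0; rewrite /stretch01.
have Dn0 := lt0r_neq0 D0; set D := 1 - r + d * r in D0 Dn0 *.
have -> : d^-1 * (d * r / D) = r / D by rewrite !mulrA mulVf ?mul1r ?lt0r_neq0.
have -> : 1 - d * r / D + r / D = D^-1.
  apply: (mulIf Dn0); rewrite mulrDl mulrBl mul1r !mulfVK // mulVf //.
  by rewrite /D addrK subrK.
by rewrite invrK mulfVK.
Qed.

Lemma stretch01_lt d r s : 0 < d -> 0 <= r < 1 -> 0 <= s < 1 ->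
  r < s -> stretch01 d r < stretch01 d s.
Proof.
move=> d0 /(stretch01_den_gt0 d0) Dr /(stretch01_den_gt0 d0) Ds rs.
rewrite /stretch01 ltr_pdivrMr // mulrAC ltr_pdivlMr // -!mulrA ltr_pM2l //.
by rewrite !mulrDr !mulr1 !mulrN (mulrCA s d) (mulrC s r) (mulrCA r d) !ltrD2r.
Qed.

Lemma frac_itv t : 0 <= t - (Num.floor t)%:~R < 1.
Proof. by rewrite subr_ge0 floor_le ltrBlDl -[1]/(1%:~R) -intrD floorD1_gt. Qed.

Lemma stretchE d (k : int) r : 0 <= r < 1 ->
  stretch d (k%:~R + r) = k%:~R + stretch01 d r.
Proof.
move=> /andP[r0 r1]; rewrite /stretch.
have -> : Num.floor (k%:~R + r) = k.
  by apply: floor_def; rewrite intrD lerDl r0 ltrD2l.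
by rewrite addrAC subrr add0r.
Qed.

Lemma floor_split t : exists (k : int) r, (0 <= r < 1) /\ t = k%:~R + r.
Proof.
exists (Num.floor t), (t - (Num.floor t)%:~R).
by split; [apply: frac_itv | rewrite addrC subrK].
Qed.

Lemma stretchK d : 0 < d -> cancel (stretch d) (stretch d^-1).
Proof.
move=> d0 t; have [k [r [r01 ->]]] := floor_split t.
by rewrite !stretchE ?stretch01_itv // stretch01K.
Qed.

Lemma stretchKV d : 0 < d -> cancel (stretch d^-1) (stretch d).
Proof. by move=> d0; rewrite -{2}[d]invrK; apply: stretchK; rewrite invr_gt0. Qed.

Lemma stretchD1 d t : 0 < d -> stretch d (t + 1) = stretch d t + 1.
Proof.
move=> d0; have [k [r [r01 ->]]] := floor_split t.
by rewrite addrAC -[1]/(1%:~R) -intrD !stretchE // intrD addrAC.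
Qed.

Lemma stretch_lt d : 0 < d -> {homo stretch d : t u / t < u}.
Proof.
move=> d0 t u; have [k [r [r01 ->]]] := floor_split t.
have [l [s [s01 ->]]] := floor_split u; rewrite !stretchE // => ltkl.
have /andP[fr0 fr1] := stretch01_itv d0 r01.
have /andP[fs0 fs1] := stretch01_itv d0 s01.
have [ltk|ltl|kl] := ltgtP k l.
- have : (k%:~R + 1 <= l%:~R :> rat) by rewrite -[1]/(1%:~R) -intrD ler_int lezD1.
  by move=> kl; rewrite (lt_le_trans _ (le_trans kl _)) ?lerDl // ltrD2l.
- have : (l%:~R + 1 <= k%:~R :> rat) by rewrite -[1]/(1%:~R) -intrD ler_int lezD1.
  move=> lk; move: ltkl; rewrite ltNge.
  case/andP: r01 => r0 _; case/andP: s01 => _ /ltW s1.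
  by rewrite (le_trans _ (le_trans lk _)) ?lerDl // lerD2l.
- by subst l; rewrite ltrD2l; apply: stretch01_lt => //; move: ltkl; rewrite ltrD2l.
Qed.

End Stretch.

Section Action.
Import Order.TTheory GRing.Theory Num.Theory.
Variables m n : nat.
Hypotheses (m_gt1 : (1 < m)%N) (n_gt1 : (1 < n)%N).
Local Open Scope ring_scope.
Local Notation d := ((m.-1 * n.-1)%:R : rat).
Local Notation R :=
  [:: (nseq m (ord0 : 'I_2, false), nseq n (ord_max : 'I_2, false))].

Let d_gt0 : 0 < d.
Proof. by rewrite ltr0n muln_gt0 -!subn1 !subn_gt0 m_gt1. Qed.
Let m_neq0 : m%:R != 0 :> rat.
Proof. by rewrite pnatr_eq0 -lt0n ltnW. Qed.
Let n_neq0 : n%:R != 0 :> rat.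
Proof. by rewrite pnatr_eq0 -lt0n ltnW. Qed.

(** The generator [x] acts as the translation by [1/m] conjugated by [stretch d].
    The factor [d = (m-1)(n-1)] is the one for which [stretch d (1/m) = 1 - 1/n],
    that is, for which [y x] and [z] agree at [0]. *)
Definition letter_act (l : 'I_2 * bool) (t : rat) : rat :=
  let e := if l.2 then - 1 else 1 in
  if l.1 == ord0 then stretch d (stretch d^-1 t + e / m%:R) else t + e / n%:R.

Definition word_act (w : word 2) (t : rat) : rat := foldr letter_act t w.

Lemma word_act_cat u v t : word_act (u ++ v) t = word_act u (word_act v t).
Proof. exact: foldr_cat. Qed.

Lemma letter_actK l : cancel (letter_act (linv l)) (letter_act l).
Proof.
case: l => i e t; rewrite /letter_act /=; case: eqP => _.
  by rewrite stretchK //; case: e; rewrite /= ?mulNr ?subrK ?addrK stretchKV.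
by case: e; rewrite /= ?mulNr ?subrK ?addrK.
Qed.

Lemma letter_act_lt l : {homo letter_act l : t u / t < u}.
Proof.
move=> t u tu; rewrite /letter_act; case: ifP => _; last by rewrite ltrD2r.
by apply: stretch_lt => //; rewrite ltrD2r stretch_lt // invr_gt0.
Qed.

Lemma word_act_lt w : {homo word_act w : t u / t < u}.
Proof. by elim: w => //= l w IH t u /IH; apply: letter_act_lt. Qed.

Lemma word_act_x k t : word_act (nseq k (ord0, false)) t =
  stretch d (stretch d^-1 t + k%:R / m%:R).
Proof.
elim: k => [|k IH] /=; first by rewrite mul0r addr0 stretchKV.
rewrite -/(word_act _ _) IH /letter_act /= stretchK // -addrA -mulrDl.
by rewrite natr1.
Qed.

Lemma word_act_y k t :
  word_act (nseq k (ord_max, false)) t = t + k%:R / n%:R.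
Proof.
elim: k => [|k IH] /=; first by rewrite mul0r addr0.
by rewrite -/(word_act _ _) IH /letter_act /= -addrA -mulrDl natr1.
Qed.

Lemma word_act_xm t : word_act (nseq m (ord0, false)) t = t + 1.
Proof. by rewrite word_act_x divff // stretchD1 // stretchKV. Qed.

Lemma word_act_eq u v : word_eq R u v -> word_act u =1 word_act v.
Proof.
elim=> {u v} //=.
- by move=> u v _ uv t; rewrite uv.
- by move=> u v w _ uv _ vw t; rewrite uv.
- by move=> u u' v v' _ uu' _ vv' t; rewrite !word_act_cat vv' uu'.
- by move=> l t; apply: letter_actK.
- move=> u v; rewrite mem_seq1 => /eqP[-> ->] t.
  by rewrite word_act_xm word_act_y divff.
Qed.

Definition Gmn_act (g : Gmn m n) : rat -> rat := word_act (repr g).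

Lemma Gmn_act_class w t : Gmn_act (word_class R w) t = word_act w t.
Proof. exact/word_act_eq/repr_word_class. Qed.

Lemma Gmn_actM (g h : Gmn m n) t : Gmn_act (g * h)%g t = Gmn_act g (Gmn_act h t).
Proof. by rewrite [LHS]Gmn_act_class word_act_cat. Qed.

Lemma Gmn_act1 t : Gmn_act 1%g t = t.
Proof. exact: Gmn_act_class. Qed.

Lemma Gmn_act_lt g : {homo Gmn_act g : t u / t < u}.
Proof. exact: word_act_lt. Qed.

Lemma Gmn_act_y t : Gmn_act (gy m n) t = t + n%:R^-1.
Proof. by rewrite Gmn_act_class /= /letter_act /= mul1r. Qed.

Lemma Gmn_act_z t : Gmn_act (gx m n ^+ m)%g t = t + 1.
Proof.
have yX k : Gmn_act (gy m n ^+ k)%g t = t + k%:R / n%:R.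
  elim: k => [|k IH]; first by rewrite Gmn_act1 mul0r addr0.
  rewrite expgS Gmn_actM IH Gmn_act_y -addrA.
  by rewrite -[X in _ + (_ + X)]mul1r -mulrDl natr1.
by rewrite Gmn_rel yX divff.
Qed.

Lemma Gmn_act_x0 : Gmn_act (gx m n) 0 = 1 - n%:R^-1.
Proof.
have st0 e : stretch e 0 = 0.
  have := @stretchE e 0 0 isT; rewrite addr0 => ->.
  by rewrite /stretch01 mulr0 mul0r addr0.
rewrite Gmn_act_class /= /letter_act /= st0 add0r mul1r.
have mV01 : 0 <= (m%:R^-1 : rat) < 1.
  by rewrite invr_ge0 ler0n /= invf_lt1 ?ltr1n // ltr0n ltnW.
have := @stretchE d 0 _ mV01; rewrite !add0r => ->.
have natB1 k : (1 < k)%N -> 1 - k%:R^-1 = k.-1%:R / k%:R :> rat.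
  move=> k_gt1; have k_neq0 : k%:R != 0 :> rat by rewrite pnatr_eq0 -lt0n ltnW.
  apply: (mulIf k_neq0); rewrite mulrBl mul1r mulVf // mulfVK //.
  by rewrite -{1}(prednK (ltnW k_gt1)) -natr1 addrK.
have m1_neq0 : m.-1%:R != 0 :> rat.
  by rewrite pnatr_eq0 -lt0n -subn1 subn_gt0.
rewrite /stretch01 !natB1 // -mulrDl -natrD -mulnS prednK ?(ltnW n_gt1) //.
by rewrite invf_div mulrA mulfVK // !natrM -mulf_div divff // mul1r.
Qed.

Section Positivity.
Local Notation x := (gx m n).
Local Notation b := (gy m n * x ^- (m - 1))%g.

(** Since [z b = y x], it suffices that [y x] moves [0] to [1], as [z] does. *)
Lemma Gmn_act_b0 : Gmn_act b 0 = 0.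
Proof.
apply: (addIr 1); rewrite -Gmn_act_z -Gmn_actM (zb (Gmn_rel m n)) //.
by rewrite Gmn_actM Gmn_act_x0 Gmn_act_y subrK add0r.
Qed.

(** Each letter preserves the order, [b] and [b^-1] fix [0], and [x] moves it up. *)
Lemma ab_product_act V t g : ab_product x b V t g ->
  if t then 0 < Gmn_act g 0 else Gmn_act g 0 == 0.
Proof.
have x0 : 0 < Gmn_act x 0.
  by rewrite Gmn_act_x0 subr_gt0 invf_lt1 ?ltr1n // ltr0n ltnW.
have fix0 u h k : Gmn_act h 0 = 0 ->
    (if u then 0 < Gmn_act k 0 else Gmn_act k 0 == 0) ->
    if u then 0 < Gmn_act (h * k)%g 0 else Gmn_act (h * k)%g 0 == 0.
  rewrite Gmn_actM; case: u => h0 => [|/eqP->]; last by rewrite h0.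
  by move=> /(Gmn_act_lt h); rewrite h0.
elim=> {t g} [|t g _ IH|t g _|t g _ _].
- by rewrite Gmn_act1.
- have : 0 <= Gmn_act g 0 by case: t IH => [/ltW|/eqP->].
  rewrite Gmn_actM le_eqVlt => /predU1P[<-|/(Gmn_act_lt x)] //.
  exact: lt_trans.
- exact/fix0/Gmn_act_b0.
- by apply: fix0; rewrite -{1}Gmn_act_b0 -Gmn_actM mulVg Gmn_act1.
Qed.

Lemma ab_product_neq1 V : ~ ab_product x b V true 1.
Proof. by move=> /ab_product_act; rewrite Gmn_act1 ltxx. Qed.

End Positivity.
End Action.

(** * Generation and conclusion *)

Section Generation.
Variables (G : groupType) (k : nat) (s : k.-tuple G).

Lemma evalV w : (eval s w)^-1 = eval s (word_inv w).
Proof.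
apply: mulg1_eq.
have : eval s (w ++ word_inv w) = eval s [::].
  by apply: (@eval_word_eq _ [::]) => //; apply: word_invr.
by rewrite /eval big_cat big_nil.
Qed.

Lemma eval_nseq p i : eval s (nseq p (i, false)) = tnth s i ^+ p.
Proof.
elim: p => [|p IH]; first by rewrite /eval big_nil.
by rewrite expgS -IH /eval big_cons.
Qed.

(** A left ordering leaves only the cone, its inverse and [1], so generating the
    cone is enough. *)
Lemma cone_generates (P : set G) :
  is_cone P -> (forall g, P g -> exists w, g = eval s w) -> generates s.
Proof.
case=> _ _ PV Pw g; have [->|/PV[/Pw//|/Pw[w gw]]] := EM (g = 1).
  by exists [::]; rewrite /eval big_nil.
by exists (word_inv w); rewrite -evalV -gw invgK.
Qed.

Lemma word_positive_eval g : word_positive s g -> exists w, g = eval s w.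
Proof.
case=> w _ ->; exists [seq (i, false) | i <- w].
by rewrite /eval big_map.
Qed.

End Generation.

Lemma sigma_positive_eval (G : groupType) (s : 2.-tuple G) g :
  sigma_positive s g -> exists w, g = eval s w.
Proof.
case=> [[w [_ _ ->]]|[p _ ->]]; first by exists w.
by exists (nseq p (ord_max, false)); rewrite eval_nseq.
Qed.

Lemma Gmn_ind m n (K : Gmn m n -> Prop) : K 1 ->
    (forall g, K g -> [/\ K (gx m n * g), K ((gx m n)^-1 * g),
                          K (gy m n * g) & K ((gy m n)^-1 * g)]) ->
  forall g, K g.
Proof.
move=> K1 Kmul g; have [w ->] := pres_generates g.
elim: w => [|[i e] w IH]; first by rewrite /eval big_nil.
rewrite /eval big_cons tnth_mktuple /=; have [Kx KxV Ky KyV] := Kmul _ IH.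
by have [->|->] := ord2P i; case: e.
Qed.

Theorem theorem4 (m n : nat) (hn : (2 <= n)%N) (hmn : (n <= m)%N)
    (h22 : (m, n) <> (2, 2)) :
  let x := gx m n in
  let y := gy m n in
  let s1 := x * y * x ^- (m - 1) in
  let s2 := x ^+ (m - 1) * y^-1 in
  let a := x in
  let b := y * x ^- (m - 1) in
  defines_Dehornoy_like [tuple s1; s2] /\ defines_isolated [tuple a; b].
Proof.
move=> x y s1 s2 a b.
have m_gt2 : (2 < m)%N.
  rewrite ltn_neqAle (leq_trans hn hmn) andbT; apply/eqP => m2; apply: h22.
  by congr (_, _) => //; apply/eqP; rewrite eqn_leq hn m2 hmn.
have m_gt1 := ltnW m_gt2.
have -> : s1 = a * b by rewrite /s1 -mulgA.
have -> : s2 = b^-1 by rewrite /s2 invgM invgK.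
have cone c := @ab_cone_is_cone _ x y m n (Gmn_rel m n) hn m_gt1
  (@Gmn_ind m n) m_gt2 (@ab_product_neq1 m n m_gt1 hn true) c.
have absorb g : ab_product a b true true g -> ab_product a b false true g.
  apply: ab_product_absorb; first exact: ab_product_bVx (Gmn_rel m n) hn m_gt1 _.
  exact: ab_product_xbV (Gmn_rel m n) hn m_gt1 _.
split; [have Es := sigma_positiveE a b | have Es := word_positiveE absorb].
- have coneS := cone _ (or_intror erefl); rewrite -Es in coneS.
  split; first exact: cone_generates coneS (@sigma_positive_eval _ _).
  exact: is_cone_left_ordering.
- have coneA := cone _ (or_introl erefl); rewrite -Es in coneA.
  split; first exact: cone_generates coneA (@word_positive_eval _ _ _).
  have [lt lo A_lt] := is_cone_left_ordering coneA.
  by exists lt => //; apply: word_positive_isolated A_lt.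
Qed.
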